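(* Let $A\in \mathbb{C}^{m\times n}$, $U\in \mathbb{C}^{m\times r}$, and $V\in \mathbb{C}^{n\times r}$, and let $S_{A}=I+V^{\ast}A^{\dagger}U\in\mathbb{C}^{r\times r}$. If $\mathcal{R}(U)\subseteq \mathcal{R}(A)$, $\mathcal{R}(V)\subseteq \mathcal{R}(A^{\ast})$, $\mathcal{R}(U^{\ast})\subseteq \mathcal{R}(S_{A})$, and $\mathcal{R}(V^{\ast})\subseteq \mathcal{R}(S_{A}^{\ast})$, then the Moore--Penrose inverse of $A+UV^{\ast}$ is given by $$(A+UV^{\ast})^{\dagger}=\big(I+A^{\dagger}UF_{S_{A}}U^{\ast}(A^{\dagger})^{\ast}\big)^{-1}\big(A^{\dagger}-A^{\dagger}US_{A}^{\dagger}V^{\ast}A^{\dagger}\big)\big(I+(A^{\dagger})^{\ast}VE_{S_{A}}V^{\ast}A^{\dagger}\big)^{-1}.$$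
   Context: $\mathbb{C}^{m\times n}$ is the set of $m\times n$ complex matrices; $I$ is an identity matrix of the appropriate size. For a complex matrix $B$, $B^{\ast}$ is its conjugate transpose, $\mathcal{R}(B)$ its range (column space), and $B^{\dagger}$ its Moore--Penrose inverse, i.e. the unique matrix $Z$ with $BZB=B$, $ZBZ=Z$, $(BZ)^{\ast}=BZ$, $(ZB)^{\ast}=ZB$. Further, $E_{B}=I-BB^{\dagger}$ and $F_{B}=I-B^{\dagger}B$. The two matrices that are inverted in the formula are identity plus Hermitian positive semidefinite matrices, hence nonsingular. *)

(* Defs.v *)
From HB Require Import structures.
From mathcomp Require Import all_boot all_order all_algebra.
From mathcomp Require Import all_classical all_reals.
From mathcomp Require Export complex.

Set Implicit Arguments.
Unset Strict Implicit.
Unset Printing Implicit Defensive.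

Import Order.TTheory GRing.Theory Num.Theory.
Local Open Scope ring_scope.
Local Open Scope sesquilinear_scope.

Section MoorePenrose.
Variable C : numClosedFieldType.

Definition is_mpinv m n (B : 'M[C]_(m, n)) (Z : 'M[C]_(n, m)) : Prop :=
  [/\ B *m Z *m B = B,
      Z *m B *m Z = Z,
      (B *m Z)^t* = B *m Z &
      (Z *m B)^t* = Z *m B].

Lemma adjmxM m n p (A : 'M[C]_(m, n)) (B : 'M[C]_(n, p)) :
  (A *m B)^t* = B^t* *m A^t*.
Proof. by rewrite trmx_mul map_mxM. Qed.

Lemma mulmx_adj_eq0 m n (A : 'M[C]_(m, n)) : A *m A^t* = 0 -> A = 0.
Proof.
move=> AA0; apply/matrixP => i j; rewrite mxE.
have /matrixP/(_ i i) := AA0; rewrite !mxE => /eqP.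
rewrite psumr_eq0; last by move=> k _; rewrite !mxE mul_conjC_ge0.
by move=> /allP/(_ j (mem_index_enum _)); rewrite !mxE mul_conjC_eq0 => /eqP.
Qed.

Lemma row_free_gram m n (A : 'M[C]_(m, n)) :
  row_free A -> A *m A^t* \in unitmx.
Proof.
move=> fA; rewrite -row_free_unit -kermx_eq0; apply/eqP.
set K := kermx _; have KA0 : K *m A *m (K *m A)^t* = 0.
  by rewrite adjmxM -mulmxA [A *m (_ *m _)]mulmxA mulmxA mulmx_ker mul0mx.
by apply: (row_free_inj fA); rewrite mul0mx; apply: mulmx_adj_eq0.
Qed.

Lemma adj_invmx n (A : 'M[C]_n) : (invmx A)^t* = invmx (A^t*).
Proof. by rewrite trmx_inv map_invmx. Qed.

Lemma mpinv_exists m n (B : 'M[C]_(m, n)) : exists Z, is_mpinv B Z.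
Proof.
have [k [P [Q [QU PU ->]]]] : exists k (P : 'M[C]_(m, k)) (Q : 'M[C]_(k, n)),
    [/\ Q *m Q^t* \in unitmx, P^t* *m P \in unitmx & B = P *m Q].
  exists (\rank B), (col_base B), (row_base B); split.
  - exact/row_free_gram/row_base_free.
  - rewrite -{2}[col_base B]trmxCK; apply: row_free_gram.
    by rewrite /row_free mxrank_map mxrank_tr; apply: col_base_full.
  - by rewrite mulmx_base.
set GQ := invmx (Q *m Q^t*); set GP := invmx (P^t* *m P).
have GQh : GQ^t* = GQ by rewrite adj_invmx adjmxM trmxCK.
have GPh : GP^t* = GP by rewrite adj_invmx adjmxM trmxCK.
pose Z := Q^t* *m GQ *m GP *m P^t*.
have BZ : P *m Q *m Z = P *m GP *m P^t*.
  by rewrite /Z !mulmxA -(mulmxA P Q) -(mulmxA P _ GQ) mulmxV // mulmx1.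
have ZB : Z *m (P *m Q) = Q^t* *m GQ *m Q.
  rewrite /Z !mulmxA -[_ *m P^t* *m P]mulmxA -[_ *m GP *m (_ *m P)]mulmxA.
  by rewrite mulVmx // mulmx1.
exists Z; split.
- by rewrite BZ !mulmxA -[_ *m P^t* *m P]mulmxA -[_ *m GP *m (_ *m P)]mulmxA
    mulVmx // mulmx1.
- by rewrite ZB /Z !mulmxA -[_ *m Q *m Q^t*]mulmxA
    -[_ *m (Q *m Q^t*) *m GQ]mulmxA mulmxV // mulmx1.
- by rewrite BZ !adjmxM GPh trmxCK mulmxA.
- by rewrite ZB !adjmxM GQh trmxCK mulmxA.
Qed.

Lemma is_mpinv_unique m n (B : 'M[C]_(m, n)) (Y Z : 'M[C]_(n, m)) :
  is_mpinv B Y -> is_mpinv B Z -> Y = Z.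
Proof.
move=> [BYB YBY BYh YBh] [BZB ZBZ BZh ZBh].
have BYZ : B *m Y = B *m Z.
  by rewrite -BYh -{1}BZB -[_ *m B *m Y]mulmxA adjmxM BYh BZh mulmxA BYB.
have YZB : Y *m B = Z *m B.
  rewrite -YBh -{1}BZB -[B *m Z *m B]mulmxA mulmxA adjmxM YBh ZBh.
  by rewrite -mulmxA [B *m _]mulmxA BYB.
by rewrite -YBY -mulmxA BYZ mulmxA YZB.
Qed.

Definition mpinv m n (B : 'M[C]_(m, n)) : 'M[C]_(n, m) :=
  projT1 (cid (mpinv_exists B)).

Lemma mpinvP m n (B : 'M[C]_(m, n)) : is_mpinv B (mpinv B).
Proof. exact: (projT2 (cid (mpinv_exists B))). Qed.

Definition projE m n (B : 'M[C]_(m, n)) : 'M[C]_m := 1%:M - B *m mpinv B.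

Definition projF m n (B : 'M[C]_(m, n)) : 'M[C]_n := 1%:M - mpinv B *m B.

(* Column space: [mulmx B] acts on column vectors, whereas the inclusions
   in [matrix_set_scope] compare row spaces. *)
Definition colrange m n (B : 'M[C]_(m, n)) : set 'cV[C]_m :=
  range (fun x : 'cV[C]_n => B *m x).

(* [invmx] is the identity outside [unitmx]; this shows that the two factors
   inverted in the update formula, both of the form I + H H^* , are units. *)
Lemma add1_gram_unit m n (H : 'M[C]_(m, n)) :
  1%:M + H *m H^t* \in unitmx.
Proof.
set K := row_mx 1%:M H.
have -> : 1%:M + H *m H^t* = K *m K^t*.
  by rewrite tr_row_mx map_col_mx mul_row_col trmx1 map_mx1 mulmx1.
apply: row_free_gram; apply/row_freeP; exists (col_mx 1%:M 0).
by rewrite mul_row_col mulmx1 mulmx0 addr0.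
Qed.

End MoorePenrose.

(* Main.v *)
Require Import Defs.
From HB Require Import structures.
From mathcomp Require Import all_boot all_order all_algebra.
From mathcomp Require Import all_classical all_reals.
From mathcomp Require Import complex.

Import GRing.Theory.
Local Open Scope ring_scope.
Local Open Scope sesquilinear_scope.
Local Open Scope classical_set_scope.

(** Write [B = A + U V^*], [a] for the Moore-Penrose inverse of [A], [S] for
    [SA], [s] for its Moore-Penrose inverse, and
    [G = a - a U s V^* a], the Sherman-Morrison-Woodbury candidate.

    Since the columns of [U] lie in the range of [A], [B a U = U + U V^* a U =
    U S]; dually [V^* a B = S V^*].  The last two range inclusions say that
    [U S s = U] and [s S V^* = V^*].  Expanding, the correction terms cancel
    and [B G = A a], [G B = a A]: both products are orthogonal projectors, and
    the Penrose equations for [B] and [G] follow from those for [A] and [a].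
    So [G] is already the Moore-Penrose inverse of [B] ([smw_is_mpinv]).

    It remains to see that the two inverted factors are identities.  With
    [F = 1 - s S] one has [B (a U F) = U S F = 0], hence
    [a U F = (a A) a U F = G B a U F = 0]; dually [(1 - S s) V^* a = 0]. *)

Section Range.
Set Implicit Arguments.
Unset Strict Implicit.

Variable C : numClosedFieldType.

(** The factorization [B = A X] is the matrix form of range inclusion; [X] is
    obtained by lifting the columns of [B] through [A], for which the
    Moore-Penrose inverse is a uniform choice of preimage. *)
Lemma colrange_sub_factor m n p (A : 'M[C]_(m, n)) (B : 'M[C]_(m, p)) :
  colrange B `<=` colrange A -> exists X, B = A *m X.
Proof.
have [AaA _ _ _] := mpinvP A.
move=> sBA; exists (mpinv A *m B); apply/matrixP => i j.
have [|x _ Ax] := sBA (col j B).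
  by exists (delta_mx j 0) => //; rewrite -colE.
have : col j (A *m (mpinv A *m B)) = col j B.
  by rewrite mulmxA colE -mulmxA -colE -Ax mulmxA AaA.
by move=> /matrixP/(_ i 0); rewrite !mxE.
Qed.

Lemma mulmx_mpinv_id m n p (A : 'M[C]_(m, n)) (B : 'M[C]_(m, p)) :
  colrange B `<=` colrange A -> A *m mpinv A *m B = B.
Proof.
have [AaA _ _ _] := mpinvP A.
by move=> /colrange_sub_factor[X ->]; rewrite mulmxA AaA.
Qed.

Lemma mulmx_mpinv_adj_id m n p (A : 'M[C]_(m, n)) (B : 'M[C]_(p, m)) :
  colrange (B^t*) `<=` colrange A -> B *m A *m mpinv A = B.
Proof.
have [_ _ Aah _] := mpinvP A.
move=> /mulmx_mpinv_id Bid.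
by rewrite -mulmxA -Aah -[B in LHS]trmxCK -adjmxM Bid trmxCK.
Qed.

(** Holds because [mpinv A *m A], being Hermitian, fixes the adjoint of [A]:
    take adjoints in the first Penrose equation. *)
Lemma mpinv_mulmx_id m n p (A : 'M[C]_(m, n)) (B : 'M[C]_(n, p)) :
  colrange B `<=` colrange (A^t*) -> mpinv A *m A *m B = B.
Proof.
have [AaA _ _ aAh] := mpinvP A.
move=> /colrange_sub_factor[X ->].
by rewrite mulmxA -aAh -adjmxM mulmxA AaA.
Qed.

Lemma mpinv_mulmx_adj_id m n p (A : 'M[C]_(m, n)) (B : 'M[C]_(n, p)) :
  colrange B `<=` colrange (A^t*) -> B^t* *m mpinv A *m A = B^t*.
Proof.
have [_ _ _ aAh] := mpinvP A.
by move=> /mpinv_mulmx_id Bid; rewrite -mulmxA -aAh -adjmxM Bid.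
Qed.

End Range.

Section Update.
Set Implicit Arguments.
Unset Strict Implicit.

Variables (C : numClosedFieldType) (m n r : nat).
Variables (A : 'M[C]_(m, n)) (U : 'M[C]_(m, r)) (V : 'M[C]_(n, r)).

Let a := mpinv A.
Let S : 'M[C]_r := 1%:M + V^t* *m a *m U.
Let s := mpinv S.
Let B := A + U *m V^t*.
Let G := a - a *m U *m s *m V^t* *m a.

Hypothesis sUA : colrange U `<=` colrange A.
Hypothesis sVA : colrange V `<=` colrange (A^t*).
Hypothesis sUS : colrange (U^t*) `<=` colrange S.
Hypothesis sVS : colrange (V^t*) `<=` colrange (S^t*).

(** Since the projector [A a] fixes [U], the two terms of [B a U] share the
    left factor [U], and what remains is exactly the definition of [S].  The
    next lemma is the dual, where [a A] is absorbed by [V^*]. *)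
Lemma update_mulmxU : B *m (a *m U) = U *m S.
Proof.
rewrite /B /S mulmxDl mulmxDr mulmx1 mulmxA (mulmx_mpinv_id sUA).
by rewrite !mulmxA.
Qed.

Lemma update_mulVmx : V^t* *m a *m B = S *m V^t*.
Proof.
rewrite /B /S mulmxDl mulmxDr mul1mx (mpinv_mulmx_adj_id sVA).
by rewrite !mulmxA.
Qed.

Lemma update_mul_smw : B *m G = A *m a.
Proof.
rewrite /G mulmxBr !mulmxA -(mulmxA B a U) update_mulmxU.
by rewrite (mulmx_mpinv_adj_id sUS) /B mulmxDl addrK.
Qed.

Lemma smw_mul_update : G *m B = a *m A.
Proof.
rewrite /G mulmxBl -!mulmxA (mulmxA (V^t*)) update_mulVmx (mulmxA s).
by rewrite (mpinv_mulmx_id sVS) /B mulmxDr addrK.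
Qed.

Lemma smw_is_mpinv : is_mpinv B G.
Proof.
have [AaA aAa Aah aAh] := mpinvP A.
split; rewrite ?update_mul_smw ?smw_mul_update //.
- by rewrite /B mulmxDr AaA mulmxA (mulmx_mpinv_id sUA).
- by rewrite /G mulmxBr !mulmxA aAa.
Qed.

(** Once [G B] is the projector [a A], which fixes [a], a matrix of the form
    [a X] vanishes as soon as [B] annihilates it; and [B] turns [a U] into
    [U S], killed by [projF S]. *)
Lemma mpinvU_projF : a *m U *m projF S = 0.
Proof.
have [SsS _ _ _] := mpinvP S.
have aAa : a *m A *m a = a by case: (mpinvP A).
rewrite -{1}aAa -smw_mul_update -!mulmxA (mulmxA a) (mulmxA B).
rewrite update_mulmxU -(mulmxA U) /projF mulmxBr mulmx1 (mulmxA S) SsS subrr.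
by rewrite !mulmx0.
Qed.

Lemma projE_mpinvV : projE S *m (V^t* *m a) = 0.
Proof.
have [SsS _ _ _] := mpinvP S.
have aAa : a *m A *m a = a by case: (mpinvP A).
rewrite -{1}aAa -(mulmxA a) -update_mul_smw !mulmxA.
rewrite -(mulmxA (projE S)) -(mulmxA (projE S)) update_mulVmx.
by rewrite mulmxA /projE mulmxBl mul1mx SsS subrr !mul0mx.
Qed.

End Update.

Theorem theorem3p2 (R : realType) (m n r : nat)
    (A : 'M[R[i]]_(m, n)) (U : 'M[R[i]]_(m, r)) (V : 'M[R[i]]_(n, r)) :
  let SA : 'M[R[i]]_r := 1%:M + V^t* *m mpinv A *m U in
  colrange U `<=` colrange A ->
  colrange V `<=` colrange (A^t*) ->
  colrange (U^t*) `<=` colrange SA ->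
  colrange (V^t*) `<=` colrange (SA^t*) ->
  mpinv (A + U *m V^t*) =
    invmx (1%:M + mpinv A *m U *m projF SA *m U^t* *m (mpinv A)^t*)
    *m (mpinv A - mpinv A *m U *m mpinv SA *m V^t* *m mpinv A)
    *m invmx (1%:M + (mpinv A)^t* *m V *m projE SA *m V^t* *m mpinv A).
Proof.
move=> SA sUA sVA sUS sVS.
rewrite (mpinvU_projF sUA sVA sVS) !mul0mx.
rewrite -(mulmxA (_ *m projE SA)) -(mulmxA _ (projE SA)) (projE_mpinvV sUA sVA sUS).
rewrite mulmx0 !addr0 !invmx1 mul1mx mulmx1.
exact: is_mpinv_unique (mpinvP _) (smw_is_mpinv sUA sVA sUS sVS).
Qed.
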